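(* Let $M_T$ be a tree metric represented by an edge-weighted tree $T$ with $n$ vertices, and let $G_T=(V(T),E)$ be the $2$-hop $1$-spanner for $M_T$ with $O(n\log n)$ edges obtained by the centroid construction described in the context. Then one can construct a routing scheme on $G_T$ (in the fixed-port model) whose local routing tables and addresses have $O(\log^2 n)$ bits, which routes between any two vertices in at most $2$ hops with stretch $1$, and which uses $O(\log\log n)$ time per vertex.
   Context: A tree metric is the shortest-path metric $\delta_T$ of an edge-weighted tree $T$. The spanner $G_T$ (Solomon's construction with hop parameter $2$) is built recursively on a subtree $T'$ with $m$ vertices: if $m\le3$, $G_{T'}=T'$, except that if $m=3$ and the root of $T'$ has exactly two children $u,v$, the edge $(u,v)$ is added; otherwise choose a vertex $c$ (computed by a fixed procedure) such that every component of $T'\setminus\{c\}$ has at most $\lceil m/2\rceil$ vertices, add edges from $c$ to all other vertices of $T'$, and recurse on each component of $T'\setminus\{c\}$. Edges are weighted by $\delta_T$. A routing scheme in the fixed-port model: each vertex's incident edges carry distinct port numbers in $\{1,\dots,\deg(v)\}$ assigned independently of the scheme; preprocessing gives each vertex an address and a local routing table; to route to $v$, at each current vertex the next port is chosen using only that vertex's routing table and the message header (which initially contains information from $v$'s address). Stretch $1$ means every route's weight equals $\delta_T(u,v)$; $2$-hop means at most $2$ edges are used. *)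

(* Defs.v *)
From HB Require Import structures.
From mathcomp Require Export all_boot all_order all_algebra.
From mathcomp Require Export all_classical all_reals all_analysis.

Set Implicit Arguments.
Unset Strict Implicit.
Unset Printing Implicit Defensive.

Export Order.TTheory GRing.Theory Num.Theory.
Export numFieldNormedType.Exports.

Section Trees.
Variables (R : realType) (V : finType) (e : rel V).

Definition is_tree : Prop :=
  [/\ symmetric e, irreflexive e, (forall x y, connect e x y)
    & (forall p : seq V, 2 < size p -> ~~ (cycle e p && uniq p))].

Definition edge_weights (wt : V -> V -> R) : Prop :=
  (forall x y, wt x y = wt y x) /\ (forall x y, e x y -> (0 < wt x y)%R).

Fixpoint walk_weight (wt : V -> V -> R) (u : V) (p : seq V) : R :=
  if p is x :: p' then (wt u x + walk_weight wt x p')%R else 0%R.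

Definition tree_dist (wt : V -> V -> R) (u v : V) : R :=
  inf [set d | exists p : seq V,
         [/\ path e u p, last u p = v & d = walk_weight wt u p]]%classic.

(* Subtrees are represented by their vertex sets. *)
Definition induced_rel (S : {set V}) : rel V :=
  [rel x y | [&& x \in S, y \in S & e x y]].

Definition is_subtree (S : {set V}) : Prop :=
  S != finset.set0 /\ {in S &, forall x y, connect (induced_rel S) x y}.

Definition components (S : {set V}) : {set {set V}} :=
  equivalence_partition (connect (induced_rel S)) S.

Variable r : V. (* the root of the whole tree *)

Definition ancestor (x y : V) : Prop :=
  forall p : seq V, path e r p -> last r p = y -> x \in r :: p.

Definition child (x y : V) : Prop := e x y /\ ancestor x y.

Definition subtree_root (S : {set V}) (x : V) : Prop :=
  x \in S /\ {in S, forall y, ancestor x y}.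

Definition centroid_procedure (cen : {set V} -> V) : Prop :=
  forall S : {set V}, is_subtree S -> 3 < #|S| ->
    cen S \in S /\
    {in components (S :\ cen S), forall C : {set V}, #|C| <= uphalf #|S|}.

Variable cen : {set V} -> V.

Inductive spanner_edge : {set V} -> V -> V -> Prop :=
| Edge_small (S : {set V}) u v :
    #|S| <= 3 -> u \in S -> v \in S -> e u v -> spanner_edge S u v
| Edge_siblings (S : {set V}) x u v :
    #|S| = 3 -> subtree_root S x -> u \in S -> v \in S -> u != v ->
    child x u -> child x v -> spanner_edge S u v
| Edge_from_centroid (S : {set V}) v :
    3 < #|S| -> v \in S :\ cen S -> spanner_edge S (cen S) v
| Edge_to_centroid (S : {set V}) v :
    3 < #|S| -> v \in S :\ cen S -> spanner_edge S v (cen S)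
| Edge_component (S C : {set V}) u v :
    3 < #|S| -> C \in components (S :\ cen S) ->
    spanner_edge C u v -> spanner_edge S u v.

Definition spanner : rel V := fun u v => `[< spanner_edge [set: V] u v >].

End Trees.

Definition port_assignment (V : finType) (G : rel V) (port : V -> V -> nat) :=
  forall v : V,
    {in [pred x | G v x] &, injective (port v)} /\
    (forall x, G v x -> 1 <= port v x <= #|[pred x | G v x]|).

(* Local computation is measured on a word RAM with w-bit words: unit-cost     *)
(* instructions, arithmetic modulo 2 ^ w.  A machine has a zero-initialised    *)
(* working memory, read-only access to the routing table of the vertex it runs *)
(* at, and read-write access to the message header; tables and headers are     *)
(* arrays of words.                                                            *)
Inductive word_op :=
  WAdd | WSub | WMul | WDiv | WMod | WAnd | WOr | WXor | WShl | WShr.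

(* d, a, b, s are addresses of working-memory cells; l is a program position. *)
Inductive instr :=
| Const (d c : nat)
| Op (o : word_op) (d a b : nat)
| MemLoad (d a : nat)
| MemStore (a s : nat)
| TableLoad (d a : nat)
| TableSize (d : nat)
| HeaderLoad (d a : nat)
| HeaderStore (a s : nat)
| HeaderSize (d : nat)
| Jump (l : nat)
| JumpEq (a b l : nat)
| JumpLt (a b l : nat)
| Deliver
| Forward (a : nat).

Definition program := seq instr.

Inductive outcome :=
| Delivered
| Forwarded (port : nat) (header : seq nat).

Record config := Config
  { cfg_pc : nat; cfg_mem : nat -> nat; cfg_header : seq nat }.

Section Machine.
Variables (P : program) (w : nat) (table : seq nat).

Definition eval_op (o : word_op) (x y : nat) : nat :=
  let M := 2 ^ w in
  match o with
  | WAdd => (x + y) %% M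
  | WSub => (x + (M - y)) %% M
  | WMul => (x * y) %% M
  | WDiv => x %/ y
  | WMod => x %% y
  | WAnd => Nat.land x y
  | WOr => Nat.lor x y
  | WXor => Nat.lxor x y
  | WShl => (x * 2 ^ y) %% M
  | WShr => x %/ 2 ^ y
  end.

Definition upd (m : nat -> nat) (d x : nat) : nat -> nat :=
  fun i => if i == d then x else m i.

Definition step (i : instr) (c : config) : config + outcome :=
  let: Config k m h := c in
  match i with
  | Const d x => inl (Config k.+1 (upd m d (x %% 2 ^ w)) h)
  | Op o d a b => inl (Config k.+1 (upd m d (eval_op o (m a) (m b))) h)
  | MemLoad d a => inl (Config k.+1 (upd m d (m (m a))) h)
  | MemStore a s => inl (Config k.+1 (upd m (m a) (m s)) h)
  | TableLoad d a => inl (Config k.+1 (upd m d (nth 0 table (m a))) h)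
  | TableSize d => inl (Config k.+1 (upd m d (size table %% 2 ^ w)) h)
  | HeaderLoad d a => inl (Config k.+1 (upd m d (nth 0 h (m a))) h)
  | HeaderStore a s =>
      inl (Config k.+1 m (if m a < size h then set_nth 0 h (m a) (m s) else h))
  | HeaderSize d => inl (Config k.+1 (upd m d (size h %% 2 ^ w)) h)
  | Jump l => inl (Config l m h)
  | JumpEq a b l => inl (Config (if m a == m b then l else k.+1) m h)
  | JumpLt a b l => inl (Config (if m a < m b then l else k.+1) m h)
  | Deliver => inr Delivered
  | Forward a => inr (Forwarded (m a) h)
  end.

(* The outcome, if reached after executing at most t instructions. *)
Fixpoint run (t : nat) (c : config) : option outcome :=
  if t is t'.+1 then
    if onth P (cfg_pc c) is Some i then
      match step i c with
      | inl c' => run t' c'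
      | inr o => Some o
      end
    else None
  else None.

Definition decide (t : nat) (h : seq nat) : option outcome :=
  run t (Config 0 (fun=> 0) h).

End Machine.

(* The machine word has Theta(log n) bits, k being the hidden constant. *)
Definition word_size (k n : nat) : nat := k * (trunc_log 2 n).+1.

Definition is_word_array (w : nat) (s : seq nat) : bool :=
  all (fun x => x < 2 ^ w) s.

Definition bit_size (w : nat) (s : seq nat) : nat := w * size s.

(* route P w t tbl G port u h p: a message with header h present at u visits   *)
(* successively the vertices of p and is delivered at the last of them, every  *)
(* vertex on the way (endpoints included) computing for at most t steps.       *)
Inductive route (P : program) (w t : nat) (V : finType) (tbl : V -> seq nat)
    (G : rel V) (port : V -> V -> nat) : V -> seq nat -> seq V -> Prop :=
| Route_deliver u h :
    decide P w (tbl u) t h = Some Delivered ->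
    route P w t tbl G port u h [::]
| Route_forward u h h' x p :
    decide P w (tbl u) t h = Some (Forwarded (port u x) h') -> G u x ->
    route P w t tbl G port x h' p ->
    route P w t tbl G port u h (x :: p).

(* Main.v *)
(** A vertex removed by the centroid recursion is adjacent in the spanner to
    every vertex of the subtree it splits.  Subtrees with at most three vertices
    are also split by such a vertex, namely the middle of the path, so the
    recursion can be run down to singletons, which takes about [log n] levels.
    If [c] is the center of the last level at which [u] and [v] lie in the same
    subtree, then [c] separates them in the tree and [u -> c -> v] is a shortest
    route.  Every vertex stores the identifiers of its centers, level by level,
    and the ports towards them; addresses store the reverse ports.  The last
    common level is found by binary search.  The intermediate vertex [c] runs
    the same program on the same header and finds itself as common center. *)
Require Import Defs.
From mathcomp Require Import all_boot all_order all_algebra.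
From mathcomp Require Import all_classical all_reals all_analysis.
From mathcomp Require Import zify.

Set Implicit Arguments.
Unset Strict Implicit.
Unset Printing Implicit Defensive.

(** * Simple paths and separators in trees *)

Section TreePaths.
Variables (V : finType) (e : rel V).
Hypothesis tree_e : is_tree e.

Let e_sym : symmetric e. Proof. by case: tree_e. Qed.
Let e_irr : irreflexive e. Proof. by case: tree_e. Qed.

Lemma induced_relE (S : {set V}) x y :
  induced_rel e S x y = [&& x \in S, y \in S & e x y].
Proof. by []. Qed.

Lemma induced_rel_sym (S : {set V}) : symmetric (induced_rel e S).
Proof. by move=> x y; rewrite !induced_relE e_sym andbCA. Qed.

Lemma path_induced (S : {set V}) x p :
  path e x p -> {subset x :: p <= S} -> path (induced_rel e S) x p.
Proof.
elim: p x => //= y p IHp x /andP[exy ep] sub.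
rewrite induced_relE exy sub ?mem_head // sub ?inE ?eqxx ?orbT //=.
by apply: IHp => // z zp; apply: sub; rewrite inE zp orbT.
Qed.

Lemma induced_path (S : {set V}) x p :
  path (induced_rel e S) x p -> path e x p /\ {subset p <= S}.
Proof.
elim: p x => //= y p IHp x /andP[/and3P[_ yS exy] /IHp[ep sub]].
by rewrite exy ep; split=> // z; rewrite inE => /predU1P[->|/sub].
Qed.

Lemma connect_induced_mem (S : {set V}) x y :
  connect (induced_rel e S) x y -> y = x \/ x \in S /\ y \in S.
Proof.
case/connectP=> -[|z p] /=; first by move=> _ ->; left.
case/andP=> /and3P[xS zS _] /induced_path[_ sub] ->; right; split=> //.
by have := mem_last z p; rewrite inE => /predU1P[->|/sub].
Qed.

Lemma connect_inducedS (S T : {set V}) x y : S \subset T ->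
  connect (induced_rel e S) x y -> connect (induced_rel e T) x y.
Proof.
move=> /fintype.subsetP sST; apply: connect_sub => a b /and3P[aS bS eab].
by apply: connect1; rewrite induced_relE !sST.
Qed.

(** A path from [x] to [y] avoiding [u] would close up through [u] to a cycle. *)
Lemma distinct_neighbours_separated u x y : e u x -> e u y -> x != y ->
  ~~ connect (induced_rel e [set~ u]) x y.
Proof.
move=> eux euy nxy; apply/negP => /connectP[p0 pth0 lst0].
case/shortenP: pth0 lst0 => p pth up _ lst.
have [ep sub] := induced_path pth.
case: tree_e => _ _ _ /(_ (u :: x :: p)).
case: p pth up lst ep sub => [|z p] _ up lst ep sub; first by rewrite lst eqxx in nxy.
move=> /(_ isT) /negP; apply; apply/andP; split.
  rewrite /cycle rcons_path /= eux -andbA; apply/andP; split=> //.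
  by move: ep => /= /andP[-> ->] /=; move: lst => /= <-; rewrite e_sym.
rewrite cons_uniq up andbT inE negb_or; apply/andP; split.
  by apply/eqP => ux; rewrite ux e_irr in eux.
by apply/negP => /sub; rewrite !inE eqxx.
Qed.

(** If the first steps differ, the two tails avoid [u] and join two distinct neighbours of [u],
    which are separated by it. *)
Lemma simple_path_unique u p q :
  path e u p -> path e u q -> uniq (u :: p) -> uniq (u :: q) ->
  last u p = last u q -> p = q.
Proof.
elim: p u q => [|x p IHp] u [|y q] //=.
- by move=> _ _ _ /andP[/negP uq _] lq; case: uq; rewrite lq mem_last.
- by move=> _ _ /andP[/negP up _] _ lp; case: up; rewrite -lp mem_last.
move=> /andP[eux ep] /andP[euy eq] /andP[up Up] /andP[uq Uq] lpq.
have [xy|nxy] := eqVneq x y; first by subst y; rewrite (IHp x q).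
have avoid z s : u \notin z :: s -> path e z s ->
    connect (induced_rel e [set~ u]) z (last z s).
  move=> nus es; apply/connectP; exists s => //; apply: path_induced => // t ts.
  by rewrite !inE; apply: contraNneq nus => <-.
case/negP: (distinct_neighbours_separated eux euy nxy).
apply: connect_trans (avoid _ _ up ep) _.
by rewrite lpq (sym_connect_sym (induced_rel_sym _)) avoid.
Qed.

(* In a tree the path inside a connected set is the only simple path, so a     *)
(* vertex separating two points of the set separates them in the whole tree.   *)
Lemma subtree_separator (S : {set V}) c u v p :
  is_subtree e S -> u \in S -> v \in S ->
  ~~ connect (induced_rel e (S :\ c)) u v ->
  path e u p -> last u p = v -> c \in u :: p.
Proof.
move=> [_ connS] uS vS nuv ep lp; apply: contraNT nuv => ncp.
case/connectP: (connS u v uS vS) => q0 eq0 lq.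
case/shortenP: eq0 lq => q eq Uq _ lq.
move: lp; case/shortenP: ep ncp => p' ep' Up' sub ncp lp.
have [eq' subq] := induced_path eq.
have epq : p' = q by apply: simple_path_unique ep' eq' Up' Uq _; rewrite lp.
apply/connectP; exists q; last by rewrite lq.
apply: path_induced => // z; rewrite !inE => zq; apply/andP; split.
  apply: contraNneq ncp => <-; rewrite inE; case/predU1P: zq => [->|zq].
    by rewrite eqxx.
  by rewrite sub ?orbT // epq.
by case/predU1P: zq => [->|/subq].
Qed.

Lemma connect_first_edge (S : {set V}) x y : x != y ->
  connect (induced_rel e S) x y -> exists2 z, z \in S & e x z.
Proof.
move=> nxy /connectP[[|z p] /=]; first by move=> _ yx; rewrite yx eqxx in nxy.
by case/andP=> /and3P[_ zS exz] _ _; exists z.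
Qed.

Lemma small_subtree_center (S : {set V}) : is_subtree e S -> #|S| <= 3 ->
  exists2 c, c \in S & {in S, forall v, v != c -> e c v}.
Proof.
move=> [/set0Pn[x xS] conn] cS.
case: (boolP [forall v in S, (v != x) ==> e x v]) => [/forall_inP H|].
  by exists x => // v /H /implyP.
case/forall_inPn => z zS; rewrite negb_imply => /andP[nzx nexz].
have nxz : x != z by rewrite eq_sym.
have [a aS exa] := connect_first_edge nxz (conn x z xS zS).
have [b bS ezb] := connect_first_edge nzx (conn z x zS xS).
have nax : a != x by apply: contraTneq exa => ->; rewrite e_irr.
have naz : a != z by apply: contraNneq nexz => <-.
(* A vertex [x] not adjacent to some [z] forces the shape [x - a - z]: the neighbour [a] of [x] is
   the third vertex, so the neighbour [b] of [z] has to be [a] as well. *)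
have SE : S = [set x; z; a].
  apply/esym/eqP; rewrite eqEcard; apply/andP; split.
    by apply/fintype.subsetP => t; rewrite !inE => /orP[/orP[]|] /eqP->.
  by rewrite finset.setUC cardsU1 cards2 !inE negb_or nax naz nxz.
have ba : b = a.
  move: bS; rewrite SE !inE => /orP[/orP[]|] /eqP // bE.
    by rewrite bE e_sym (negbTE nexz) in ezb.
  by rewrite bE e_irr in ezb.
exists a => // v; rewrite SE !inE => /orP[/orP[]|] /eqP -> //.
- by rewrite e_sym.
- by rewrite e_sym -ba.
- by rewrite eqxx.
Qed.

End TreePaths.

(** * Additivity of the tree metric at separators *)

Section TreeDistance.
Variables (R : realType) (V : finType) (e : rel V) (wt : V -> V -> R).
Hypotheses (tree_e : is_tree e) (wt_e : edge_weights e wt).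

Definition walk_weights (u v : V) : classical_sets.set R :=
  [set d | exists p : seq V,
     [/\ path e u p, last u p = v & d = walk_weight wt u p]]%classic.

Lemma walk_weight_ge0 u p : path e u p -> (0 <= walk_weight wt u p)%R.
Proof.
elim: p u => //= x p IHp u /andP[eux /IHp]; apply: addr_ge0.
by case: wt_e => _ /(_ _ _ eux) /ltW.
Qed.

Lemma walk_weight_cat u p q :
  walk_weight wt u (p ++ q) = (walk_weight wt u p + walk_weight wt (last u p) q)%R.
Proof. by elim: p u => [|x p IHp] u /=; rewrite ?add0r // IHp addrA. Qed.

Lemma has_inf_walk_weights u v : has_inf (walk_weights u v).
Proof.
split; last by exists 0%R => _ [p [ep _ ->]]; apply: walk_weight_ge0.
case: tree_e => _ _ /(_ u v) /connectP[p ep lp] _.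
by exists (walk_weight wt u p), p.
Qed.

Lemma tree_dist_refl u : tree_dist e wt u u = 0%R.
Proof.
apply/eqP; rewrite eq_le; apply/andP; split.
  by apply: ge_inf; [case: (has_inf_walk_weights u u) | exists [::]].
apply: lb_le_inf; first by case: (has_inf_walk_weights u u).
by move=> _ [p [ep _ ->]]; apply: walk_weight_ge0.
Qed.

(** Walks from [u] to [v] split at [c], and walks to and from [c] concatenate, so the weights form a
    sumset, whose infimum is the sum of the infima. *)
Lemma tree_dist_separator u c v :
  (forall p, path e u p -> last u p = v -> c \in u :: p) ->
  tree_dist e wt u v = (tree_dist e wt u c + tree_dist e wt c v)%R.
Proof.
move=> sep; rewrite /tree_dist -!/(walk_weights _ _) -inf_sumE;
  try exact: has_inf_walk_weights.
congr (inf _); apply/seteqP; split=> d.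
  case=> p [ep lp ->]; have cp := sep p ep lp.
  case/splitPl: cp ep lp => p1 p2 lp1; rewrite cat_path last_cat lp1 => /andP[ep1 ep2] lp2.
  exists (walk_weight wt u p1); first by exists p1.
  exists (walk_weight wt c p2); first by exists p2.
  by rewrite walk_weight_cat lp1.
case=> _ [p [ep lp ->]] [_ [q [eq lq ->]] <-]; exists (p ++ q).
by rewrite cat_path last_cat walk_weight_cat lp ep.
Qed.

End TreeDistance.

(** * The centroid decomposition, level by level *)

Section Decomposition.
Variables (V : finType) (e : rel V) (r : V) (cen : {set V} -> V).
Hypotheses (tree_e : is_tree e) (cen_e : centroid_procedure e cen).
Implicit Types (S : {set V}) (u v : V).

Let e_irr : irreflexive e. Proof. by case: tree_e. Qed.

(** Extends [cen] to subtrees with at most three vertices by a vertex adjacent to all others; [r] is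
    only a default value, never reached on a subtree. *)
Definition center S : V :=
  if 3 < #|S| then cen S
  else odflt r [pick c in S | [forall v in S, (v != c) ==> e c v]].

Lemma small_centerP S : is_subtree e S -> #|S| <= 3 ->
  center S \in S /\ {in S, forall v, v != center S -> e (center S) v}.
Proof.
move=> treeS cS; rewrite /center ltnNge cS /=.
case: pickP => [c /andP[cS' /forall_inP ecS]|none] /=.
  by split=> // v /ecS /implyP.
have [c cS' ecS] := small_subtree_center tree_e treeS cS.
have /negP[] := negbT (none c); rewrite cS'; apply/forall_inP => v vS.
by apply/implyP => /(ecS v vS).
Qed.

Lemma mem_center S : is_subtree e S -> center S \in S.
Proof.
move=> treeS; have [cS|cS] := leqP #|S| 3; first by case: (small_centerP treeS cS).
by rewrite /center cS; case: (cen_e treeS cS).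
Qed.

(** The subtree containing [v] after [i] rounds. As [connect] is reflexive, the cell of a removed
    center becomes a singleton and stays one, so cells exist at every level for every vertex. *)
Fixpoint cell i v : {set V} :=
  if i is j.+1 then
    [set y | connect (induced_rel e (cell j v :\ center (cell j v))) v y]
  else [set: V].

Lemma mem_cell i v : v \in cell i v.
Proof. by case: i => [|i]; rewrite inE. Qed.

Lemma cellS_sub i v : cell i.+1 v \subset cell i v.
Proof.
apply/fintype.subsetP => y; rewrite inE => /connect_induced_mem[->|[_]].
  exact: mem_cell.
by rewrite inE => /andP[].
Qed.

(** The cells of one level are classes of a partition, since [connect] is symmetric here. *)
Lemma cell_eq i u v : u \in cell i v -> cell i u = cell i v.
Proof.
elim: i u v => // i IHi u v uv.
have cuv := IHi u v (fintype.subsetP (cellS_sub i v) _ uv).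
apply/setP => y; move: uv; rewrite /= !inE cuv => uv.
exact/esym/same_connect/uv/sym_connect_sym/induced_rel_sym.
Qed.

Lemma cell_subtree i v : is_subtree e (cell i v).
Proof.
split; first by apply/set0Pn; exists v; apply: mem_cell.
have csym := sym_connect_sym (induced_rel_sym tree_e (cell i v)).
suff from_v x : x \in cell i v -> connect (induced_rel e (cell i v)) v x.
  by move=> x y /from_v vx /from_v vy; apply: connect_trans vy; rewrite csym.
case: i {csym} => [_|i].
  case: tree_e => _ _ /(_ v x) /connectP[p ep ->] _.
  by apply/connectP; exists p => //; apply: path_induced => // z _; rewrite inE.
rewrite inE => /connectP[p ep ->]; apply/connectP; exists p => //.
apply: path_induced => [|z zp]; first by case: (induced_path ep).
by rewrite inE; apply: (fingraph.path_connect ep zp).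
Qed.

Lemma cell_center i v : v = center (cell i v) -> cell i.+1 v = [set v].
Proof.
move=> vc; apply/setP => y; rewrite !inE -vc.
apply/idP/eqP => [/connect_induced_mem[//|[]]|->]; last exact: connect0.
by rewrite !inE eqxx.
Qed.

Lemma cell_component i v (S := cell i v) : v != center S ->
  cell i.+1 v \in components e (S :\ center S).
Proof.
move=> vc; apply/imsetP; exists v; first by rewrite !inE vc mem_cell.
apply/setP => y; rewrite [LHS]inE [RHS]inE andb_idl //.
move/connect_induced_mem => [->|[]//]; by rewrite !inE vc mem_cell.
Qed.

(** The remaining vertices are distinct neighbours of the center, hence separated by its removal. *)
Lemma small_cellS i v : #|cell i v| <= 3 -> cell i.+1 v = [set v].
Proof.
move=> cS; have [_ adj] := small_centerP (cell_subtree i v) cS.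
have [/cell_center//|vc] := eqVneq v (center (cell i v)).
apply/setP => y; rewrite !inE; apply/idP/eqP => [|->]; last exact: connect0.
have [//|nyv] := eqVneq y v => cvy.
have yS : y \in cell i v :\ center (cell i v).
  by case: (connect_induced_mem cvy) nyv => [->|[]//]; rewrite eqxx.
move: yS; rewrite !inE => /andP[yc yS].
have nvy : v != y by rewrite eq_sym.
case/negP: (distinct_neighbours_separated tree_e (adj _ (mem_cell i v) vc)
  (adj _ yS yc) nvy).
by apply: connect_inducedS cvy; apply/fintype.subsetP => z; rewrite !inE => /andP[].
Qed.

(** Bounding sizes by powers of two makes the rounding up in the centroid condition harmless. *)
Lemma card_cellS k i v : #|cell i v| <= 2 ^ k.+1 -> #|cell i.+1 v| <= 2 ^ k.
Proof.
move=> cS; have [/small_cellS->|c3] := leqP #|cell i v| 3.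
  by rewrite cards1 expn_gt0.
have [/cell_center->|vc] := eqVneq v (center (cell i v)).
  by rewrite cards1 expn_gt0.
have := cell_component vc; rewrite {1}/center c3.
case: (cen_e (cell_subtree i v) c3) => _ /[apply] /leq_trans; apply.
by rewrite uphalfE leq_half_double; rewrite expnS mul2n in cS; lia.
Qed.

Lemma cell_singleton L v : #|V| <= 2 ^ L -> cell L v = [set v].
Proof.
move=> VL; apply/esym/eqP; rewrite eqEcard cards1 finset.sub1set mem_cell /=.
suff: forall i, i <= L -> #|cell i v| <= 2 ^ (L - i).
  by move/(_ L (leqnn L)); rewrite subnn.
elim=> [|i IHi] iL; first by rewrite cardsT subn0.
by apply: card_cellS; rewrite -subSn // subSS IHi // ltnW.
Qed.

(** Rules out edges in singleton cells, the levels at which [cell] no longer follows the recursion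
    of [spanner_edge]. *)
Lemma spanner_edge_card S u v : spanner_edge e r cen S u v -> 1 < #|S|.
Proof.
case=> {}S.
- move=> {}u {}v _ uS vS euv; rewrite (cardsD1 u) uS (cardsD1 v) !inE vS andbT.
  by case: eqP euv => // ->; rewrite e_irr.
- by move=> ? ? ? ->.
- by move=> ? /ltnW/ltnW.
- by move=> ? /ltnW/ltnW.
- by move=> ? ? ? /ltnW/ltnW.
Qed.

Lemma spanner_cell i v a b : spanner_edge e r cen (cell i v) a b -> spanner e r cen a b.
Proof.
elim: i => [|i IHi] ab; first exact/asboolP.
apply: IHi; have [/small_cellS vE|c3] := leqP #|cell i v| 3.
  by move/spanner_edge_card: ab; rewrite vE cards1.
have [/cell_center vE|vc] := eqVneq v (center (cell i v)).
  by move/spanner_edge_card: ab; rewrite vE cards1.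
apply: Edge_component ab => //.
by have := cell_component vc; rewrite {1}/center c3.
Qed.

Lemma spanner_center i v (c := center (cell i v)) : v != c ->
  spanner e r cen c v /\ spanner e r cen v c.
Proof.
move=> vc; split; apply: (@spanner_cell i v);
  have [c3|c3] := leqP #|cell i v| 3.
- have [cS adj] := small_centerP (cell_subtree i v) c3.
  by apply: Edge_small => //; [apply: mem_cell | apply: adj => //; apply: mem_cell].
- move: vc; rewrite /c /center c3 => vc.
  by apply: Edge_from_centroid; rewrite // !inE vc mem_cell.
- have [cS adj] := small_centerP (cell_subtree i v) c3.
  apply: Edge_small => //; first exact: mem_cell.
  by case: tree_e => -> _ _ _; apply: adj => //; apply: mem_cell.
- move: vc; rewrite /c /center c3 => vc.
  by apply: Edge_to_centroid; rewrite // !inE vc mem_cell.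
Qed.

(** A center lies in its cell and cells of one level are disjoint, so comparing centers amounts to
    comparing cells. *)
Lemma cell_center_eq i u v : center (cell i u) = center (cell i v) ->
  cell i u = cell i v.
Proof.
move=> cc; have cu := mem_center (cell_subtree i u).
by rewrite -(cell_eq cu) cc (cell_eq (mem_center (cell_subtree i v))).
Qed.

(** The next cells differ, so removing [c] disconnects [u] from [v] within their common subtree, and
    then [c] separates them in the whole tree. *)
Lemma separation_level i u v (c := center (cell i u)) :
  center (cell i u) = center (cell i v) ->
  center (cell i.+1 u) <> center (cell i.+1 v) ->
  forall p, path e u p -> last u p = v -> c \in u :: p.
Proof.
move=> cc nc p; apply: (@subtree_separator _ _ tree_e (cell i u)).
- exact: cell_subtree.
- exact: mem_cell.
- by rewrite (cell_center_eq cc) mem_cell.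
apply/negP => uv; apply: nc; congr center; apply/esym/cell_eq.
by rewrite inE.
Qed.

Lemma cell_mono i j v : i <= j -> cell j v \subset cell i v.
Proof.
move/subnK <-; elim: (j - i) => // d IHd.
exact: fintype.subset_trans (cellS_sub (d + i) v) IHd.
Qed.

Lemma cell_eq_le i j u v : i <= j -> cell j u = cell j v -> cell i u = cell i v.
Proof.
move=> ij uv; apply: cell_eq; apply: (fintype.subsetP (cell_mono v ij)).
by rewrite -uv mem_cell.
Qed.

Lemma cell_of_center i v : cell i (center (cell i v)) = cell i v.
Proof. exact/cell_eq/mem_center/cell_subtree. Qed.

(** A center is alone in its cell from the next level on, hence is its own center there. *)
Lemma center_of_center i j v (c := center (cell i v)) : i <= j ->
  center (cell j c) = c.
Proof.
rewrite leq_eqVlt => /predU1P[<-|ij]; first by rewrite /c cell_of_center.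
have cE : cell i.+1 c = [set c] by apply: cell_center; rewrite cell_of_center.
have := fintype.subsetP (cell_mono c ij) _ (mem_center (cell_subtree j c)).
by rewrite cE inE => /eqP.
Qed.

End Decomposition.

(** * The routing program and its execution *)

(* Cells 0 and 1 hold the bounds of the binary search, 2 and 3 the constants 1  *)
(* and 2, 7 half the table length, 8 the identifier of the current vertex; 4,   *)
(* 5, 6 are scratch.                                                            *)
Definition routing_program : program :=
  [:: Const 2 1; Const 3 2; TableSize 7; Op WDiv 7 7 3; Op WSub 1 7 2;
      TableLoad 8 1; HeaderLoad 6 1; JumpEq 8 6 26;
      (* position 8: head of the search loop *)
      Op WAdd 4 0 2; JumpEq 4 1 19;
      Op WAdd 4 0 1; Op WDiv 4 4 3; TableLoad 5 4; HeaderLoad 6 4;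
      JumpEq 5 6 17;
      Op WDiv 1 4 2; Jump 8;
      Op WDiv 0 4 2; Jump 8;
      (* position 19: cell 0 is the last common level *)
      TableLoad 5 0; Op WAdd 7 7 0; JumpEq 5 8 24;
      TableLoad 5 7; Forward 5;
      HeaderLoad 5 7; Forward 5;
      Deliver].

Section Program.
(** [a] and [b] stand for the center identifiers of the current vertex and of the target, [pa] for
    ports towards centers, [pb] for ports from centers to the target. The bound on [2 ^ w] keeps the
    sums of levels and offsets from wrapping around. *)
Variables (w L : nat) (a b pa pb : nat -> nat) (tbl hdr : seq nat).
Hypotheses (w_big : 2 * L + 4 < 2 ^ w) (size_tbl : size tbl = 2 * L.+1).
Hypotheses (tbl_center : forall i, i <= L -> nth 0 tbl i = a i)
           (tbl_port : forall i, i <= L -> nth 0 tbl (L.+1 + i) = pa i)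
           (hdr_center : forall i, i <= L -> nth 0 hdr i = b i)
           (hdr_port : forall i, i <= L -> nth 0 hdr (L.+1 + i) = pb i).

Record search_state (m : nat -> nat) (lo hi : nat) : Prop := SearchState {
  state_lo : m 0 = lo; state_hi : m 1 = hi; state_one : m 2 = 1;
  state_two : m 3 = 2; state_half : m 7 = L.+1; state_self : m 8 = a L }.

Let exec t k m := run routing_program w tbl t (Config k m hdr).

(** [a L] is the current vertex: if it is the common center, the header supplies the port to the
    target, otherwise the table supplies the port to the center. *)
Lemma exec_forward m t lo hi : search_state m lo hi -> lo <= L ->
  exec (t + 5) 19 m =
  Some (Forwarded (if a lo == a L then pb lo else pa lo) hdr).
Proof.
move=> [m0 m1 m2 m3 m7 m8] loL; rewrite addnC /exec /=.
rewrite /upd /= m0 m7 m8 tbl_center //.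
have -> : (L.+1 + lo) %% 2 ^ w = L.+1 + lo by apply: modn_small; lia.
by case: eqP => _ /=; rewrite ?tbl_port ?hdr_port.
Qed.

Lemma exec_search_done m t lo : search_state m lo lo.+1 -> lo < L ->
  exec (t + 7) 8 m =
  Some (Forwarded (if a lo == a L then pb lo else pa lo) hdr).
Proof.
move=> st loL; have [m0 m1 m2 m3 m7 m8] := st.
rewrite -(@exec_forward (upd m 4 lo.+1) t lo lo.+1) //; last exact: ltnW.
rewrite [t + 7](_ : _ = 2 + (t + 5)); last by lia.
rewrite /exec /= /upd /= m0 m1 m2 addn1 modn_small ?eqxx //.
by lia.
Qed.

Lemma exec_search_step m t lo hi (mid := (lo + hi) %/ 2) :
  search_state m lo hi -> lo.+1 < hi -> hi <= L ->
  exists m', exec (9 + t) 8 m = exec t 8 m' /\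
    if a mid == b mid then search_state m' mid hi else search_state m' lo mid.
Proof.
move=> [m0 m1 m2 m3 m7 m8] lohi hiL.
have lo1 : (lo + 1) %% 2 ^ w = lo + 1 by apply: modn_small; lia.
have lhi : (lo + hi) %% 2 ^ w = lo + hi by apply: modn_small; lia.
have nlh : (lo + 1 == hi) = false by lia.
have midL : mid <= L by rewrite /mid; lia.
rewrite /exec /= /upd /= m0 m1 m2 lo1 nlh /= m0 m1 lhi m3 -/mid.
rewrite tbl_center // hdr_center //; case: eqP => _ /=.
  (* Dividing by cell 2, which holds 1, is how the program copies the midpoint into a bound. *)
  by eexists; split; [reflexivity | split; rewrite /upd //= ?m2 ?divn1].
by eexists; split; [reflexivity | split; rewrite /upd //= ?m2 ?divn1].
Qed.

(** The invariant is agreement at [lo] and disagreement at [hi]. Each round takes 9 instructions and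
    halves the gap; at gap 1 the change of level is found, and time left over is absorbed. *)
Lemma exec_search j m t lo hi : search_state m lo hi ->
  lo < hi <= L -> hi - lo <= 2 ^ j -> a lo = b lo -> a hi != b hi ->
  exists i, [/\ i < L, a i = b i, a i.+1 != b i.+1 &
    exec (t + 9 * j + 7) 8 m =
    Some (Forwarded (if a i == a L then pb i else pa i) hdr)].
Proof.
elim: j m t lo hi => [|j IHj] m t lo hi st /andP[lohi hiL] le alo ahi.
  have hiE : hi = lo.+1 by rewrite expn0 in le; lia.
  by subst hi; exists lo; split=> //; apply: exec_search_done.
have [hiE|nhi] := eqVneq hi lo.+1.
  by subst hi; exists lo; split=> //; apply: exec_search_done.
have lohi' : lo.+1 < hi by lia.
rewrite [_ + _](_ : _ = 9 + (t + 9 * j + 7)); last by lia.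
have [m' [-> st']] := exec_search_step (t + 9 * j + 7) st lohi' hiL.
rewrite expnS in le.
case: eqP st' => [amid|/eqP amid] st'; apply: IHj st' _ _ _ _ => //; lia.
Qed.

Lemma exec_init t : exists m, search_state m 0 L /\
  decide routing_program w tbl (8 + t) hdr =
  exec t (if a L == b L then 26 else 8) m.
Proof.
have c1 : 1 %% 2 ^ w = 1 by apply: modn_small; lia.
have c2 : 2 %% 2 ^ w = 2 by apply: modn_small; lia.
have sz : size tbl %% 2 ^ w %/ 2 = L.+1.
  by rewrite size_tbl modn_small ?mulKn //; lia.
(* Subtraction adds the complement modulo [2 ^ w], so this sum does wrap around, to the last
   level. *)
have sub1 : (L.+1 + (2 ^ w - 1)) %% 2 ^ w = L.
  by rewrite [_ + _](_ : _ = L + 2 ^ w) ?modnDr ?modn_small //; lia.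
rewrite /decide /= /upd /= c1 c2 sz sub1 tbl_center // hdr_center //.
by eexists; split; last reflexivity; split; rewrite /upd //=.
Qed.

Lemma decide_deliver t : a L = b L ->
  decide routing_program w tbl (t + 9) hdr = Some Delivered.
Proof.
move=> abL; rewrite addnS -addSn addnC.
by have [m [_ ->]] := exec_init t.+1; rewrite abL eqxx.
Qed.

Lemma decide_forward j t : L <= 2 ^ j -> a 0 = b 0 -> a L != b L ->
  exists i, [/\ i < L, a i = b i, a i.+1 != b i.+1 &
    decide routing_program w tbl (t + 9 * j + 15) hdr =
    Some (Forwarded (if a i == a L then pb i else pa i) hdr)].
Proof.
move=> Lj ab0 nabL; have L0 : 0 < L by case: L ab0 nabL => // ->; rewrite eqxx.
(* 8 instructions initialise, 7 leave the loop and forward. *)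
rewrite [_ + 15](_ : _ = 8 + (t + 9 * j + 7)); last by lia.
have [m [st ->]] := exec_init (t + 9 * j + 7); rewrite (negbTE nabL).
by apply: (exec_search t st) => //; rewrite ?L0 ?subn0 /=.
Qed.

End Program.

(** * Logarithmic bounds *)

Section Asymptotics.
Variable R : realType.
Implicit Types n : nat.
Local Open Scope classical_set_scope.
Local Open Scope ring_scope.

Lemma near_ln_ge (C : R) : \forall n \near \oo%classic, C <= ln (n%:R : R).
Proof.
have := nbhs_infty_ger (expR C); apply: filterS => n Cn.
by rewrite -[C]expRK ler_ln ?posrE ?expR_gt0 // (lt_le_trans (expR_gt0 C)).
Qed.

Lemma near_ln_ln_ge (C : R) :
  \forall n \near \oo%classic, C <= ln (ln (n%:R : R)).
Proof.
have := near_ln_ge (expR C); apply: filterS => n Cn.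
by rewrite -[C]expRK ler_ln ?posrE ?expR_gt0 // (lt_le_trans (expR_gt0 C)).
Qed.

Let ln2_gt0 : 0 < ln (2 : R). Proof. by rewrite ln_gt0 // ltr1n. Qed.

Lemma expn2_le_ln k (x : R) : (2 ^ k)%:R <= x -> k%:R * ln 2 <= ln x.
Proof.
move=> kx; rewrite mulr_natl -lnXn // -natrX ler_ln // posrE.
  by rewrite ltr0n expn_gt0.
by apply: lt_le_trans kx; rewrite ltr0n expn_gt0.
Qed.

Lemma trunc_log_le_ln n : (0 < n)%N -> (trunc_log 2 n)%:R <= (ln 2)^-1 * ln (n%:R : R).
Proof.
move=> n0; rewrite ler_pdivlMl // mulrC expn2_le_ln // ler_nat.
by case/andP: (trunc_log_bounds (isT : (1 < 2)%N) n0).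
Qed.

Lemma trunc_log_sqr_bigO (c : nat) :
  (fun n => (c * ((trunc_log 2 n).+1 * (trunc_log 2 n).+1))%N%:R : R) =O_\oo
  (fun n => ln (n%:R : R) ^+ 2).
Proof.
(* Once [ln n >= 1], the successor in [(trunc_log 2 n).+1] costs at most one more [ln n]. *)
set K := (ln 2)^-1 + 1 : R.
have K0 : 0 < K by rewrite addr_gt0 // invr_gt0.
apply/eqO_exP; exists (c.+1%:R * K ^+ 2); first by rewrite mulr_gt0 ?exprn_gt0.
have := near_ln_ge 1; apply: filterS => n ln1.
have n0 : (0 < n)%N.
  by case: n ln1 => // H; move: H; rewrite ln0 // ler10.
have le : (trunc_log 2 n).+1%:R <= K * ln (n%:R : R).
  by rewrite -natr1 mulrDl mul1r lerD // trunc_log_le_ln.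
rewrite !ger0_norm ?exprn_ge0 ?(le_trans _ ln1) //.
rewrite -mulrA -exprMn natrM ler_pM ?ler_nat // natrM expr2.
by rewrite ler_pM.
Qed.

Lemma up_log_trunc_log_bigO (c d : nat) :
  (fun n => (c + d * up_log 2 (trunc_log 2 n).+1)%N%:R : R) =O_\oo
  (fun n => ln (ln (n%:R : R))).
Proof.
set K := (ln 2)^-1 + 1 : R.
have K0 : 0 < K by rewrite addr_gt0 // invr_gt0.
(* From [1 + (ln K + ln (ln n)) / ln 2], where [ln (ln n) >= 1] absorbs both the 1 and [ln K]. *)
set J := 1 + (ln 2)^-1 * (`|ln K| + 1).
have J0 : 0 < J by rewrite ltr_wpDr // mulr_ge0 ?invr_ge0 ?ltW // ltr_wpDl.
apply/eqO_exP; exists (c.+1%:R + d%:R * J).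
  by rewrite ltr_wpDr // mulr_ge0 // ltW.
have := near_ln_ln_ge 1; apply: filterS2 (near_ln_ge 1) => n ln1 lln1.
have n0 : (0 < n)%N.
  by case: n ln1 lln1 => // H; move: H; rewrite ln0 // ler10.
have le : (trunc_log 2 n).+1%:R <= K * ln (n%:R : R).
  by rewrite -natr1 mulrDl mul1r lerD // trunc_log_le_ln.
have ln_n0 : 0 < ln (n%:R : R) by apply: lt_le_trans ln1.
have up : (up_log 2 (trunc_log 2 n).+1)%:R <= J * ln (ln (n%:R : R)).
  set l := trunc_log 2 n in le *.
  (* The minimality of [up_log] used below requires [l.+1 > 1]. *)
  have [l0|l0] := posnP l.
    by rewrite l0 up_log1 mulr_ge0 // ltW // (lt_le_trans _ lln1).
  have up_gt : (2 ^ (up_log 2 l.+1).-1 < l.+1)%N by rewrite up_log_gtn.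
  have := @expn2_le_ln (up_log 2 l.+1).-1 (K * ln (n%:R : R)).
  rewrite lnM ?posrE // => /(_ (le_trans _ le)); rewrite ler_nat => /(_ (ltnW up_gt)).
  rewrite mulrC -ler_pdivlMl // => uple.
  have -> : up_log 2 l.+1 = (up_log 2 l.+1).-1.+1 by rewrite prednK // up_log_gt0.
  rewrite -natr1 addrC mulrDl mul1r lerD // (le_trans uple) // -mulrA.
  rewrite ler_wpM2l ?invr_ge0 ?(ltW ln2_gt0) // mulrDl mul1r lerD //.
  by rewrite (le_trans (ler_norm _)) // ler_peMr.
rewrite !ger0_norm ?(le_trans _ lln1) // natrD natrM mulrDl lerD //.
  by apply: (@le_trans _ _ c.+1%:R); rewrite ?ler_nat // ler_peMr.
by rewrite -mulrA ler_wpM2l.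
Qed.
End Asymptotics.

(** * Memory layout of tables and addresses *)

Section LevelArrays.
Variable L : nat.

(** Tables and addresses share one layout, so a level has the same index in both, and its port lies
    [L.+1] words further. *)
Definition level_array (f g : nat -> nat) := mkseq f L.+1 ++ mkseq g L.+1.

Lemma size_level_array f g : size (level_array f g) = 2 * L.+1.
Proof. by rewrite size_cat !size_mkseq; lia. Qed.

Lemma nth_level_array_id f g i : i <= L -> nth 0 (level_array f g) i = f i.
Proof. by move=> iL; rewrite nth_cat size_mkseq ltnS iL nth_mkseq. Qed.

Lemma nth_level_array_port f g i : i <= L ->
  nth 0 (level_array f g) (L.+1 + i) = g i.
Proof.
by move=> iL; rewrite nth_cat size_mkseq ltnNge leq_addr /= addKn nth_mkseq.
Qed.

End LevelArrays.

(** * Correctness of the routing scheme *)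

Section Routing.
Variables (R : realType) (V : finType) (e : rel V) (wt : V -> V -> R) (r : V).
Variables (cen : {set V} -> V) (port : V -> V -> nat) (w L : nat).
Hypotheses (tree_e : is_tree e) (wt_e : edge_weights e wt).
Hypotheses (cen_e : centroid_procedure e cen).
Hypothesis port_G : port_assignment (spanner e r cen) port.
Hypotheses (card_L : #|V| < 2 ^ L) (L_w : L <= w) (w_big : 2 * L + 4 < 2 ^ w).
Implicit Types u v : V.

Let G := spanner e r cen.
Let ctr i v := center e r cen (cell e r cen i v).
Let card_w : #|V| < 2 ^ w.
Proof. by apply: leq_trans card_L _; rewrite leq_exp2l. Qed.

Definition vertex_id v : nat := enum_rank v.

Lemma vertex_id_inj : injective vertex_id.
Proof. by move=> u v /ord_inj/enum_rank_inj. Qed.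

(* A port towards oneself is meaningless and may be arbitrarily large; the     *)
(* reduction modulo the word size only matters for such entries.               *)
Definition vertex_table u :=
  level_array L (fun i => vertex_id (ctr i u)) (fun i => port u (ctr i u) %% 2 ^ w).

Definition vertex_address v :=
  level_array L (fun i => vertex_id (ctr i v)) (fun i => port (ctr i v) v %% 2 ^ w).

Lemma level_array_words (c : nat -> V) g :
  is_word_array w (level_array L (fun i => vertex_id (c i)) (fun i => g i %% 2 ^ w)).
Proof.
rewrite /is_word_array all_cat; apply/andP; split; apply/allP => _ /mapP[i _ ->].
  exact: ltn_trans (ltn_ord _) card_w.
by rewrite ltn_mod expn_gt0.
Qed.

(** A port is at most the degree, hence below [2 ^ w], so the reduction loses nothing on edges. *)
Lemma port_word u v : G u v -> port u v %% 2 ^ w = port u v.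
Proof.
move=> uv; rewrite modn_small //; have [_ /(_ v uv) /andP[_ le]] := port_G u.
by apply: leq_ltn_trans card_w; apply: leq_trans le _; apply: max_card.
Qed.

(** The last cell is a singleton, so the last identifier stored is that of the vertex itself; the
    program uses it to recognise the target. *)
Lemma ctr_last v : ctr L v = v.
Proof.
have VL := cell_singleton r tree_e cen_e v (ltnW card_L).
have := mem_center r tree_e cen_e (cell_subtree r cen tree_e L v).
by rewrite /ctr VL inE => /eqP.
Qed.

Let time j := 9 * j + 15.

Lemma vertex_deliver j v :
  decide routing_program w (vertex_table v) (time j) (vertex_address v) =
  Some Delivered.
Proof.
rewrite /time [_ + _](_ : _ = 9 * j + 6 + 9); last by lia.
apply: (@decide_deliver w L (fun i => vertex_id (ctr i v))
  (fun i => vertex_id (ctr i v))) => //.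
- exact: size_level_array.
- exact: nth_level_array_id.
- exact: nth_level_array_id.
Qed.

Lemma vertex_forward j u v : L <= 2 ^ j -> u != v ->
  exists i, [/\ ctr i u = ctr i v, ctr i.+1 u <> ctr i.+1 v &
    decide routing_program w (vertex_table u) (time j) (vertex_address v) =
    Some (Forwarded (if ctr i u == u then port u v else port u (ctr i u))
                    (vertex_address v))].
Proof.
move=> Lj uv.
have [||i [iL ii iS dec]] := @decide_forward w L
  (fun i => vertex_id (ctr i u)) (fun i => vertex_id (ctr i v))
  (fun i => port u (ctr i u) %% 2 ^ w) (fun i => port (ctr i v) v %% 2 ^ w)
  (vertex_table u) (vertex_address v) w_big (size_level_array L _ _)
  (@nth_level_array_id L _ _) (@nth_level_array_port L _ _)
  (@nth_level_array_id L _ _) (@nth_level_array_port L _ _) j 0 Lj.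
(* At level 0 all vertices share the cell [[set: V]], hence the center. *)
- by [].
- by rewrite /= !ctr_last (inj_eq vertex_id_inj).
move/vertex_id_inj: ii => ii.
exists i; split=> //; first by move=> eqS; rewrite eqS eqxx in iS.
rewrite /time -[9 * j]add0n dec ctr_last (inj_eq vertex_id_inj) -ii.
case: eqP => [cu|/eqP cu]; congr (Some (Forwarded _ _)); rewrite ?cu port_word //.
  have vc : v != center e r cen (cell e r cen i v) by rewrite -/(ctr i v) -ii cu eq_sym.
  by have [] := spanner_center tree_e vc; rewrite -/(ctr i v) -ii cu.
have uc : u != center e r cen (cell e r cen i u) by rewrite eq_sym.
by have [] := spanner_center tree_e uc.
Qed.

Lemma routing_correct j u v : L <= 2 ^ j -> exists p : seq V,
  [/\ route routing_program w (time j) vertex_table G port u (vertex_address v) p,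
      last u p = v, size p <= 2 &
      walk_weight (tree_dist e wt) u p = tree_dist e wt u v].
Proof.
move=> Lj; have [<-|uv] := eqVneq u v.
  exists [::]; split=> //; last by rewrite /= tree_dist_refl.
  exact/Route_deliver/vertex_deliver.
have [i [ii iS dec]] := vertex_forward Lj uv; set c := ctr i u in ii dec.
have to_v : c != v -> G c v.
  rewrite eq_sym ii => vc; by have [] := spanner_center tree_e vc.
have to_c : c != u -> G u c.
  by rewrite eq_sym => uc; have [] := spanner_center tree_e uc.
(* If the common center is [u] or [v], a single hop suffices. *)
have direct : decide routing_program w (vertex_table u) (time j) (vertex_address v) =
    Some (Forwarded (port u v) (vertex_address v)) -> G u v -> exists p : seq V,
  [/\ route routing_program w (time j) vertex_table G port u (vertex_address v) p,
      last u p = v, size p <= 2 &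
      walk_weight (tree_dist e wt) u p = tree_dist e wt u v].
  move=> d g; exists [:: v]; split=> //=; last by rewrite addr0.
  exact/(Route_forward d g)/Route_deliver/vertex_deliver.
have [cu|cu] := eqVneq c u.
  by apply: direct; [rewrite dec cu eqxx | rewrite -cu; apply: to_v; rewrite cu].
rewrite (negbTE cu) in dec.
have [cv|cv] := eqVneq c v.
  by apply: direct; [rewrite dec cv | rewrite -cv; apply: to_c].
exists [:: c; v]; split=> //=; last first.
  rewrite addr0 [RHS](@tree_dist_separator _ _ _ _ tree_e wt_e u c) //.
  exact: (separation_level tree_e cen_e ii iS).
apply: (Route_forward dec (to_c cu)); have [i' [ii' iS' dec']] := vertex_forward Lj cv.
apply: (Route_forward _ (to_v cv)); last exact/Route_deliver/vertex_deliver.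
rewrite dec'.
suff -> : ctr i' c = c by rewrite eqxx.
have [le|lt] := leqP i i'; first exact: (center_of_center r tree_e cen_e u le).
case: iS'; congr (center e r cen _); apply: cell_eq_le lt _ => //.
rewrite /c cell_of_center //; exact: (cell_center_eq tree_e cen_e ii).
Qed.

End Routing.

(** * Choice of constants and conclusion *)

(** Fixes the word size constant 3: for [l = 0] this reads [6 < 8], and a factor 2 would fail. *)
Lemma word_size_big l : 2 * l.+1 + 4 < 2 ^ (3 * l.+1).
Proof. by elim: l => // l IHl; rewrite [3 * _]mulnS expnD; lia. Qed.

Local Open Scope classical_set_scope.

Theorem theorem5p1 (R : realType) :
  exists (P : program) (k : nat) (bits time : nat -> nat),
    [/\ (fun n : nat => (bits n)%:R : R)%R =O_\oo
          (fun n : nat => ln (n%:R : R) ^+ 2)%R,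
        (fun n : nat => (time n)%:R : R)%R =O_\oo
          (fun n : nat => ln (ln (n%:R : R)))%R &
        forall (V : finType) (e : rel V) (wt : V -> V -> R) (r : V)
               (cen : {set V} -> V) (port : V -> V -> nat),
          let n := #|V| in
          let w := word_size k n in
          let G := spanner e r cen in
          let dT := tree_dist e wt in
          is_tree e -> edge_weights e wt -> centroid_procedure e cen ->
          port_assignment G port ->
          exists addr tbl : V -> seq nat,
            [/\ (forall v, is_word_array w (addr v) && is_word_array w (tbl v)),
                (forall v, bit_size w (addr v) <= bits n),
                (forall v, bit_size w (tbl v) <= bits n) &
                forall u v : V, exists p : seq V,
                  [/\ route P w (time n) tbl G port u (addr v) p,
                      last u p = v, size p <= 2 &
                      walk_weight dT u p = dT u v]]].
Proof.
pose L n := (trunc_log 2 n).+1.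
(* An array has [2 * (L n).+1] words of [3 * L n] bits, and [(L n).+1 <= 2 * L n] gives the factor
   12. *)
exists routing_program, 3, (fun n => 12 * (L n * L n)).
(* The binary search over [L n] levels takes at most [up_log 2 (L n)] rounds. *)
exists (fun n => 15 + 9 * up_log 2 (L n)); split.
- exact: trunc_log_sqr_bigO.
- exact: up_log_trunc_log_bigO.
move=> V e wt r cen port n w G dT tree_e wt_e cen_e port_G.
have n0 : 0 < n by apply/card_gt0P; exists r.
have card_L : #|V| < 2 ^ L n by case/andP: (trunc_log_bounds (isT : 1 < 2) n0).
have L_w : L n <= w by rewrite /w /word_size -/(L n) leq_pmull.
have w_big : 2 * L n + 4 < 2 ^ w by apply: word_size_big.
exists (vertex_address e r cen port w (L n)), (vertex_table e r cen port w (L n)).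
split.
- by move=> v; rewrite !level_array_words.
- move=> v; rewrite /bit_size size_level_array /w /word_size -/(L n) /L; nia.
- move=> v; rewrite /bit_size size_level_array /w /word_size -/(L n) /L; nia.
move=> u v; rewrite addnC.
by apply: routing_correct => //; apply: up_logP.
Qed.
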